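(* Let $$z^* := \left((1-b)\mathbf{1}+(a+b-1)\,Z_S^0\,\tilde A_{S,F}\right)\left(I-(a+b-1)\tilde A_F\right)^{-1}.$$ Then $Z_F^t\to z^*$ almost surely as $t\to\infty$, if either of the following holds: (i) the reinforcement is of non-Pólya type, that is, $R\neq mI$ and $a+b>0$; (ii) $S\neq\emptyset$ and for every $f\in F$ there exists $s\in S$ such that $s\rightsquigarrow f$.
   Context: Graph. $G=(V,E)$ is a finite directed graph with $V=\{1,\dots,N\}$ and $E\subseteq V\times V$. Write $i\to j$ if $(i,j)\in E$, and $i\rightsquigarrow j$ if there is a directed path from $i$ to $j$. Let $V(i)=\{j\in V:(j,i)\in E\}$, $d_i^{\mathrm{in}}=|V(i)|$, $d_i^{\mathrm{out}}=|\{j:(i,j)\in E\}|$. There are no isolated vertices (no $i$ with $d_i^{\mathrm{in}}=d_i^{\mathrm{out}}=0$). Put $S=\{i:d_i^{\mathrm{in}}=0\}$ (stubborn vertices) and $F=\{i:d_i^{\mathrm{in}}>0\}$ (flexible vertices), with vertices ordered so that $F=\{1,\dots,|F|\}$. Urn process. At each vertex $i$ there is an urn with $W_i^t$ white and $B_i^t$ black balls at time $t\ge 0$; the initial configuration is fixed, with $T_i^0:=W_i^0+B_i^0\ge 1$. Fix a positive integer $m$ and $\alpha,\beta\in\{0,1,\dots,m\}$, and put $R=\begin{pmatrix}\alpha & m-\alpha\\ m-\beta&\beta\end{pmatrix}$, $a=\alpha/m$, $b=\beta/m$. Let $Z_i^t=W_i^t/(W_i^t+B_i^t)$, $Z^t=(Z_1^t,\dots,Z_N^t)$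 and $\mathcal F_t=\sigma(Z^0,\dots,Z^t)$. At time $t+1$ a ball is drawn uniformly at random from every urn (and put back); $Y_i^{t+1}$ is the indicator that the ball drawn from urn $i$ is white. Conditionally on $\mathcal F_t$, the $Y_i^{t+1}$, $i\in V$, are independent with $P(Y_i^{t+1}=1\mid\mathcal F_t)=Z_i^t$. Then for every $i\in V$ $$W_i^{t+1}=W_i^t+\sum_{j\in V(i)}\left[\alpha Y_j^{t+1}+(m-\beta)(1-Y_j^{t+1})\right],\qquad B_i^{t+1}=B_i^t+\sum_{j\in V(i)}\left[(m-\alpha) Y_j^{t+1}+\beta(1-Y_j^{t+1})\right].$$ In particular urns in $S$ never change. Notation. Vectors are row vectors; $Z^t=(Z_F^t,Z_S^0)$, where a subscript denotes restriction to that index set. $\mathbf 1$ is an all-ones row vector of appropriate dimension and $I$ an identity matrix. $\tilde A$ is the $N\times N$ scaled adjacency matrix with $\tilde A_{i,j}=1/d_j^{\mathrm{in}}$ if $i\to j$, and $0$ otherwise; $\tilde A_F$ is its $F\times F$ block and $\tilde A_{S,F}$ its block with rows in $S$ and columns in $F$. If $S=\emptyset$, the term $Z_S^0\tilde A_{S,F}$ is $\mathbf 0$. *)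

(* Defs.v *)
From HB Require Import structures.
From mathcomp Require Import all_boot all_order all_algebra.
From mathcomp Require Import all_classical all_reals all_analysis.

Set Implicit Arguments.
Unset Strict Implicit.
Unset Printing Implicit Defensive.

Import Order.TTheory GRing.Theory Num.Theory.
Import numFieldNormedType.Exports.

Local Open Scope classical_set_scope.
Local Open Scope ring_scope.

Section Conditioning.
Context (d : measure_display) (Omega : measurableType d) (R : realType).
Context (P : probability Omega R).

(* [f] is a version of the conditional probability of the event [A] given the
   sub-sigma-algebra [G]. *)
Definition is_cond_prob (G : set (set Omega)) (A : set Omega)
    (f : Omega -> R) : Prop :=
  [/\ forall C : set R, measurable C -> G (f @^-1` C),
      P.-integrable setT (EFin \o f) &
      forall C, G C -> (\int[P]_(w in C) (f w)%:E)%E = P (A `&` C)].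

(* Some of the sets [C i] may be [setT], so the product rule for the whole
   family contains the one for every subfamily.  Quantifying over all the
   versions [p i] is harmless: versions exist and are a.e. unique. *)
Definition cond_independent (G : set (set Omega)) (I : finType)
    (d' : measure_display) (T : measurableType d')
    (X : I -> {RV P >-> T}) : Prop :=
  forall (C : I -> set T) (p : I -> Omega -> R),
    (forall i, measurable (C i)) ->
    (forall i, is_cond_prob G (X i @^-1` C i) (p i)) ->
    is_cond_prob G (\bigcap_(i in [set: I]) X i @^-1` C i)
      (fun w => \prod_i p i w).

End Conditioning.

Section Graph.
Context (N : nat) (E : rel 'I_N).

Definition in_nbrs (i : 'I_N) : {set 'I_N} := [set j | E j i]%SET.

Definition in_degree (i : 'I_N) : nat := #|in_nbrs i|.

Definition out_degree (i : 'I_N) : nat := #|[set j | E i j]%SET|.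

Definition no_isolated_vertex : Prop :=
  forall i, ~ (in_degree i = 0%N /\ out_degree i = 0%N).

Definition stubborn : {set 'I_N} := [set i | in_degree i == 0%N]%SET.

Definition flexible : {set 'I_N} := [set i | (0 < in_degree i)%N]%SET.

Definition scaled_adjacency (R : realType) : 'M[R]_N :=
  \matrix_(i, j) (if E i j then (in_degree j)%:R^-1 else 0).

End Graph.

(* Restrictions to index sets: the entries of an index set [J] are listed in
   increasing order by [enum_val : 'I_#|J| -> 'I_N]. *)
Definition subrow (R : realType) (N : nat) (J : {set 'I_N}) (v : 'rV[R]_N) :
    'rV[R]_#|J| :=
  \row_j v 0 (enum_val j).

Definition submat (R : realType) (N : nat) (J K : {set 'I_N}) (M : 'M[R]_N) :
    'M[R]_(#|J|, #|K|) :=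
  \matrix_(j, k) M (enum_val j) (enum_val k).

Definition replacement_mx (m alpha beta : nat) : 'M[int]_2 :=
  \matrix_(i, j)
    (if i == 0 then (if j == 0 then alpha%:Z else m%:Z - alpha%:Z)
     else (if j == 0 then m%:Z - beta%:Z else beta%:Z)).

Definition white_fraction (R : realType) (w b : nat) : R :=
  w%:R / (w%:R + b%:R).

Section Urns.
Context (d : measure_display) (Omega : measurableType d) (R : realType).
Context (P : probability Omega R) (N : nat).

Section Fractions.
Context (W B : nat -> 'I_N -> Omega -> nat).

Definition Z (t : nat) (w : Omega) : 'rV[R]_N :=
  \row_i white_fraction R (W t i w) (B t i w).

Definition Z_filtration (t : nat) : set (set Omega) :=
  <<s [set A | exists s i (C : set R),
         [/\ (s <= t)%N, measurable C & A = (fun w => Z s w 0 i) @^-1` C]] >>.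

End Fractions.

(* [Y t i] is true when the ball drawn from urn [i] at time [t] is white; the
   first draw is at time 1, so [Y 0] plays no role.  The urn updates are in
   [nat], where a boolean stands for 0 or 1. *)
Record urn_process (E : rel 'I_N) (m alpha beta : nat) (W0 B0 : 'I_N -> nat)
    (W B : nat -> 'I_N -> Omega -> nat) (Y : nat -> 'I_N -> {RV P >-> bool}) :
    Prop := UrnProcess {
  urn_W0 : forall i w, W 0%N i w = W0 i;
  urn_B0 : forall i w, B 0%N i w = B0 i;
  urn_WS : forall t i w,
    W t.+1 i w = (W t i w + \sum_(j in in_nbrs E i)
      (alpha * Y t.+1 j w + (m - beta) * (1 - Y t.+1 j w)))%N;
  urn_BS : forall t i w,
    B t.+1 i w = (B t i w + \sum_(j in in_nbrs E i)
      ((m - alpha) * Y t.+1 j w + beta * (1 - Y t.+1 j w)))%N;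
  urn_draw : forall t i,
    is_cond_prob P (Z_filtration W B t) [set w | Y t.+1 i w = true]
      (fun w => Z W B t w 0 i);
  urn_indep : forall t, cond_independent (Z_filtration W B t) (Y t.+1) }.

End Urns.

Section Limit.
Context (R : realType) (N : nat) (E : rel 'I_N) (a b : R).

Let S := stubborn E.
Let F := flexible E.
Let A : 'M[R]_N := scaled_adjacency E R.

Definition limit_mx : 'M[R]_#|F| :=
  1%:M - (a + b - 1) *: submat F F A.

(* [invmx] is total (the identity on singular matrices), so the formula has its
   intended meaning only when [limit_mx \in unitmx]. *)
Definition limit_row (Z0 : 'rV[R]_N) : 'rV[R]_#|F| :=
  ((1 - b) *: const_mx 1 + (a + b - 1) *: (subrow S Z0 *m submat S F A))
    *m invmx limit_mx.

End Limit.

(* Main.v *)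
(* The proportions satisfy an averaging recursion: dividing the number of
   white balls by the (deterministic) total gives, for flexible i,
     Z_i^t = (1 - b) + c \sum_j mean_t(Z_j) A_(j,i) + U_i^t / (t d_i) + O(1/t),
   where c = a + b - 1, A is the scaled adjacency matrix, mean_t is the Cesaro
   mean over times s < t, and U_i^t is c times the sum of the centred draws at
   the in-neighbours of i up to time t.  The
   increments of U_i are bounded and orthogonal to its past, so E (U_i^t)^2 is
   O(t), and U_i^t / t -> 0 almost surely, first along the squares and then
   along all t.
   On that event let L_i be the limsup of |Z_i^t - z_i|, where z is the fixed
   point of the averaged equation.  A Cesaro mean does not increase the limsup,
   so L <= |c| L A on flexible vertices while L = 0 on stubborn ones; a maximum
   principle then forces L = 0.  The same principle shows that I - c A_F is
   invertible. *)
Require Import Defs.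
From HB Require Import structures.
From mathcomp Require Import all_boot all_order all_algebra.
From mathcomp Require Import all_classical all_reals all_analysis.
From mathcomp Require Import measurable_realfun lra ring zify.

Set Implicit Arguments.
Unset Strict Implicit.
Unset Printing Implicit Defensive.

Import Order.TTheory GRing.Theory Num.Theory.
Import numFieldNormedType.Exports.

Local Open Scope classical_set_scope.
Local Open Scope ring_scope.

(** * Maximum principle for averages over in-neighbours *)

Section MaximumPrinciple.
Context (R : realType) (N : nat) (E : rel 'I_N).

Local Notation A := (scaled_adjacency E R).

Lemma flexible_edge (i j : 'I_N) : E j i -> i \in flexible E.
Proof.
move=> Eji; rewrite inE /in_degree card_gt0; apply/set0Pn; exists j.
by rewrite inE.
Qed.

Lemma stubbornE (i : 'I_N) : (i \in stubborn E) = (i \notin flexible E).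
Proof. by rewrite !inE -eqn0Ngt. Qed.

Lemma sum_scaled_adjacency (f : 'I_N -> R) (i : 'I_N) :
  \sum_j f j * A j i = (\sum_(j in in_nbrs E i) f j) / (in_degree E i)%:R.
Proof.
rewrite mulr_suml [RHS]big_mkcond/=; apply: eq_bigr => j _.
by rewrite mxE inE; case: ifP; rewrite ?mulr0.
Qed.

Lemma scaled_adjacency_ge0 (i j : 'I_N) : 0 <= A i j.
Proof. by rewrite mxE; case: ifP => // _; rewrite invr_ge0. Qed.

Lemma scaled_adjacency_gt0 (i j : 'I_N) : E i j -> 0 < A i j.
Proof.
by move=> Eij; rewrite mxE Eij invr_gt0 ltr0n; have := flexible_edge Eij; rewrite inE.
Qed.

Lemma column_sum_scaled_adjacency (i : 'I_N) :
  i \in flexible E -> \sum_j A j i = 1.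
Proof.
rewrite inE => di.
under eq_bigr do rewrite -[A _ _]mul1r.
by rewrite sum_scaled_adjacency sumr_const divff// pnatr_eq0 -lt0n.
Qed.

(** The two alternatives are what hypotheses (i) and (ii) give for [c = a + b - 1]. In the second,
    [|c| = 1] is allowed and the stubborn vertices provide the contraction. *)
Definition contracting (c : R) : Prop :=
  `|c| < 1 \/
  `|c| <= 1 /\ forall f, f \in flexible E ->
    exists2 s, s \in stubborn E & connect E s f.

(** An average never exceeds the maximum of [L]. If that maximum is positive, [|c| < 1] is
    contradictory at a maximiser; otherwise equality spreads the maximum backwards along edges to a
    stubborn vertex, where [L] vanishes. *)
Lemma maximum_principle (c : R) (L : 'I_N -> R) :
  contracting c -> (forall i, 0 <= L i) ->
  (forall i, i \in stubborn E -> L i = 0) ->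
  (forall i, i \in flexible E -> L i <= `|c| * \sum_j L j * A j i) ->
  forall i, L i = 0.
Proof.
move=> cE L0 LS LF i1.
have [i0 _ Lmax] := @Order.TotalTheory.arg_maxP _ R _ i1 xpredT L erefl.
have {}Lmax i : L i <= L i0 by exact: Lmax.
suff Li0 : L i0 = 0.
  by apply/eqP; rewrite eq_le L0 andbT -Li0 Lmax.
apply: contrapT => /eqP Li0.
have M0 : 0 < L i0 by rewrite lt_neqAle eq_sym Li0 L0.
have flex i : L i = L i0 -> i \in flexible E.
  move=> e; apply: contraT; rewrite -stubbornE => /LS Li.
  by move: M0; rewrite -e Li ltxx.
have avg i : i \in flexible E -> \sum_j L j * A j i <= L i0.
  move=> iF; rewrite -[leRHS]mulr1 -(column_sum_scaled_adjacency iF) mulr_sumr.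
  by apply: ler_sum => j _; rewrite ler_wpM2r ?scaled_adjacency_ge0.
have i0F := flex i0 erefl.
case: cE => [c1|[c1 reach]].
  have := LF _ i0F; apply/negP; rewrite -ltNge.
  apply: (@le_lt_trans _ _ (`|c| * L i0)); first by rewrite ler_wpM2l ?avg.
  by rewrite gtr_pMl.
(* In-neighbours have positive weight, so a single one below the maximum would pull the average
   strictly below it. *)
have back i j : L i = L i0 -> E j i -> L j = L i0.
  move=> e Eji; apply/eqP; rewrite eq_le Lmax leNgt; apply/negP => Lj.
  have iF := flex _ e; have := LF _ iF; apply/negP; rewrite -ltNge e.
  apply: (@le_lt_trans _ _ (1 * \sum_j L j * A j i)).
    rewrite ler_wpM2r// sumr_ge0// => k _.
    by rewrite mulr_ge0 ?scaled_adjacency_ge0.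
  rewrite mul1r -[ltRHS]mulr1 -(column_sum_scaled_adjacency iF) mulr_sumr.
  rewrite (bigD1 j)//= [ltRHS](bigD1 j)//= ltr_leD//.
    by rewrite ltr_pM2r ?scaled_adjacency_gt0.
  by apply: ler_sum => k _; rewrite ler_wpM2r ?scaled_adjacency_ge0.
have [s /LS sS /connectP[p + e]] := reach _ i0F.
elim: p s sS e => [|x p IH] s sS /= e; first by rewrite e sS eqxx in Li0.
(* The next vertex [x] need not satisfy [L x = 0], so the outer induction hypothesis gives way to a
   fresh induction along the rest of the path. *)
have {}IH : path E x p -> L x = L i0.
  clear sS IH; elim: p x e => [|y p IH] x /= e; first by rewrite e.
  by case/andP=> Exy /(IH _ e) Ly; apply: back Exy.
by case/andP=> Esx /IH Lx; move: Li0; rewrite -(back _ _ Lx Esx) sS eqxx.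
Qed.

End MaximumPrinciple.

(** * Cesaro means and the recursion for the deviations *)

Section CesaroRecursion.
Context (R : realType).

(* [mean u 0 = 0], as [x / 0 = 0]. *)
Definition mean (u : nat -> R) (t : nat) : R := (\sum_(s < t) u s) / t%:R.

(** The excess of [|u t|] over [r] is eventually zero, so its Cesaro mean tends to 0. *)
Lemma eventual_bound_mean (u : nat -> R) (r e : R) : 0 < e ->
  (\forall t \near \oo, `|u t| <= r) ->
  \forall t \near \oo, `|mean u t| <= r + e.
Proof.
move=> e0 ur.
pose v t : R := Num.max (`|u t| - r) 0.
have v0 : v t @[t --> \oo] --> 0.
  apply: cvg_near_cst; near=> t; apply/eqP; rewrite /v max_r// subr_le0.
  by near: t.
have /cvgrPdist_le/(_ _ e0) mv := cesaro v0.
(* [arithmetic_mean v t] averages [t + 1] terms, hence the shift to [mean u t.+1]. *)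
apply: near_inftyS; near=> t.
have -> : mean u t.+1 = (\sum_(0 <= s < t.+1) u s) / t.+1%:R.
  by rewrite /mean big_mkord.
have : `|0 - arithmetic_mean v t| <= e by near: t.
rewrite sub0r normrN /arithmetic_mean /series/= => mvt.
rewrite normrM [X in _ * X]ger0_norm ?invr_ge0// ler_pdivrMr// mulrDl.
apply: (le_trans (ler_norm_sum _ _ _)).
apply: (@le_trans _ _ (\sum_(0 <= s < t.+1) (r + v s))).
  by apply: ler_sum => s _; rewrite -lerBlDl le_max lexx.
rewrite big_split/= sumr_const_nat subn0 -[r *+ _]mulr_natr lerD2l.
by rewrite -ler_pdivrMr// (le_trans _ mvt)// mulrC ler_norm.
Unshelve. all: by end_near. Qed.

(** [L] is the limsup of [|u|], realised as the infimum of its eventual bounds. *)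
Lemma limsup_norm (u : nat -> R) (K : R) : (forall t, `|u t| <= K) ->
  exists L, [/\ 0 <= L,
    forall e, 0 < e -> \forall t \near \oo, `|u t| <= L + e &
    forall r, (\forall t \near \oo, `|u t| <= r) -> L <= r].
Proof.
move=> uK; pose B := [set r | \forall t \near \oo, `|u t| <= r].
have B_ge0 r : B r -> 0 <= r.
  by case=> n _ /(_ n (leqnn n)) /=; apply: le_trans.
have BK : B K by exact: nearW.
have hB : has_inf B by split; [exists K | exists 0 => r /B_ge0].
exists (inf B); split.
- by apply: lb_le_inf; [exists K | move=> r /B_ge0].
- move=> e e0; have [r Br rB] := inf_adherent e0 hB.
  by apply: filterS Br => t /le_trans; apply; exact: ltW.
- by move=> r Br; apply: ge_inf Br; exists 0 => q /B_ge0.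
Qed.

Lemma mean_recursion_cvg (N : nat) (E : rel 'I_N) (c : R)
    (x : 'I_N -> nat -> R) (K : R) :
  contracting E c -> (forall i t, `|x i t| <= K) ->
  (forall i t, i \in stubborn E -> x i t = 0) ->
  (forall i, i \in flexible E ->
    x i t - c * \sum_j mean (x j) t * scaled_adjacency E R j i @[t --> \oo]
      --> 0) ->
  forall i, x i t @[t --> \oo] --> 0.
Proof.
move=> cE xK xS xF.
have /choice[L LP] : forall i, exists L, [/\ 0 <= L,
    forall e, 0 < e -> \forall t \near \oo, `|x i t| <= L + e &
    forall r, (\forall t \near \oo, `|x i t| <= r) -> L <= r].
  by move=> i; apply: limsup_norm.
have L0 : forall i, L i = 0.
  apply: (maximum_principle cE) => [i|i iS|i iF].
  - by have [] := LP i.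
  - have [Li0 _ Lmin] := LP i; apply/eqP; rewrite eq_le Li0 andbT Lmin//.
    by apply: nearW => t; rewrite xS// normr0.
  - have [_ _ Lmin] := LP i; apply/ler_addgt0Pr => e e0.
    (* One third is for the recursion error, one for the limsup bound and one for the passage to the
       mean. *)
    have e3 : 0 < e / 3 by rewrite divr_gt0.
    apply: Lmin; near=> t.
    have xb : `|0 - (x i t - c * \sum_j mean (x j) t * scaled_adjacency E R j i)|
        <= e / 3.
      by near: t; move/cvgrPdist_le: (xF _ iF); apply.
    have mb j : `|mean (x j) t| <= (L j + e / 3) + e / 3.
      move: j; near: t; apply: filter_forall => j.
      by apply: eventual_bound_mean => //; have [_ + _] := LP j; apply.
    have sb : `|\sum_j mean (x j) t * scaled_adjacency E R j i| <=
        (\sum_j L j * scaled_adjacency E R j i) + (e / 3 + e / 3).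
      apply: (le_trans (ler_norm_sum _ _ _)).
      (* The factor 1 is expanded as a column sum, which spreads the error over the vertices with
         the weights of the average. *)
      rewrite -[X in _ <= _ + X]mulr1.
      rewrite -[X in _ <= _ + _ * X](column_sum_scaled_adjacency R iF) mulr_sumr.
      rewrite -big_split/=; apply: ler_sum => j _.
      rewrite normrM (ger0_norm (scaled_adjacency_ge0 _ _ _ _)) -[leRHS]mulrDl.
      by rewrite ler_wpM2r ?scaled_adjacency_ge0// addrA mb.
    have c1 : `|c| <= 1 by case: cE => [/ltW|[]].
    have cs : `|c * \sum_j mean (x j) t * scaled_adjacency E R j i| <=
        `|c| * (\sum_j L j * scaled_adjacency E R j i) + (e / 3 + e / 3).
      rewrite normrM; apply: (le_trans (ler_wpM2l (normr_ge0 _) sb)).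
      by rewrite mulrDr lerD2l ler_piMl// addr_ge0// ltW.
    rewrite sub0r normrN in xb.
    rewrite -[x i t](subrK (c * \sum_j mean (x j) t * scaled_adjacency E R j i)).
    apply: (le_trans (ler_normD _ _)); apply: (le_trans (lerD xb cs)).
    by lra.
move=> i; apply/cvgrPdist_le => e e0.
have [_ /(_ _ e0) + _] := LP i; rewrite L0 add0r; apply: filterS => t.
by rewrite sub0r normrN.
Unshelve. all: by end_near. Qed.

End CesaroRecursion.

(** * Invertibility of the limit matrix and the fixed-point equation *)

Lemma row_extension (R : realType) (N : nat) (J : {set 'I_N}) (v : 'rV[R]_#|J|)
    (f : 'I_N -> R) : exists z : 'I_N -> R,
  (forall k, z (enum_val k) = v 0 k) /\ (forall i, i \notin J -> z i = f i).
Proof.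
(* For [i] in [J] exactly one index [k] qualifies, so the sum selects the entry of [v] listed at
   [i]. *)
exists (fun i => if i \in J then \sum_(k < #|J| | enum_val k == i) v 0 k else f i).
split=> [k|i /negPf -> //]; rewrite enum_valP.
rewrite (eq_bigl (pred1 k)) ?big_pred1_eq// => l.
by rewrite (inj_eq enum_val_inj).
Qed.

Section Limit.
Context (R : realType) (N : nat) (E : rel 'I_N) (a b : R).
Hypothesis cE : contracting E (a + b - 1).

Local Notation S := (stubborn E).
Local Notation F := (flexible E).
Local Notation A := (scaled_adjacency E R).

(** For [v] in the left kernel, the absolute values of its extension by 0 to the stubborn vertices
    obey the maximum principle, so [v = 0]. *)
Lemma limit_mx_unit : limit_mx E a b \in unitmx.
Proof.
rewrite -row_free_unit; apply: inj_row_free => v.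
rewrite /limit_mx mulmxBr mulmx1 -scalemxAr => /eqP; rewrite subr_eq0 => /eqP ve.
have [x [xE x0]] := row_extension v (fun=> 0).
have x_eq0 := @maximum_principle R N E (a + b - 1) (fun i => `|x i|) cE.
apply/rowP => k; rewrite mxE -xE; apply/normr0_eq0; apply: x_eq0.
- by move=> i; exact: normr_ge0.
- by move=> i iS; rewrite x0 ?normr0// -stubbornE.
move=> i iF; have [l ->] : exists l : 'I_#|F|, i = enum_val l.
  by exists (enum_rank_in iF i); rewrite enum_rankK_in.
rewrite xE ve !mxE normrM ler_wpM2l//.
apply: (@le_trans _ _ (\sum_(j in F) `|x j| * A j (enum_val l))); last first.
  rewrite [leRHS](bigID (mem F))/= lerDl sumr_ge0// => j _.
  by rewrite mulr_ge0// scaled_adjacency_ge0.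
rewrite [leRHS]big_enum_val/=.
apply: (le_trans (ler_norm_sum _ _ _)).
apply: ler_sum => j _; rewrite xE normrM -/A [submat _ _ _ _ _]mxE.
by rewrite [X in _ * X <= _]ger0_norm// scaled_adjacency_ge0.
Qed.

(** Placing the initial proportions at the stubborn vertices turns the linear system behind
    [limit_row] into an averaging equation over all vertices, of the same shape as the urn
    recursion. *)
Lemma limit_fixed_point (Z0 : 'rV[R]_N) : exists z : 'I_N -> R,
  [/\ forall k, z (enum_val k) = limit_row E a b Z0 0 k,
      forall i, i \in S -> z i = Z0 0 i &
      forall i, i \in F ->
        z i = (1 - b) + (a + b - 1) * \sum_j z j * A j i].
Proof.
pose v := limit_row E a b Z0.
have [z [zF zS']] := row_extension v (Z0 0).
have zS i : i \in S -> z i = Z0 0 i by rewrite stubbornE => /zS'.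
exists z; split => // i iF.
have [l ->] : exists l : 'I_#|F|, i = enum_val l.
  by exists (enum_rank_in iF i); rewrite enum_rankK_in.
rewrite zF (bigID (mem F))/= big_enum_val/=.
rewrite [X in _ * (_ + X)](eq_bigl (mem S)); last first.
  by move=> j /=; rewrite -stubbornE.
rewrite [X in _ * (_ + X)]big_enum_val/=.
have : v *m limit_mx E a b = (1 - b) *: const_mx 1 +
    (a + b - 1) *: (subrow S Z0 *m submat S F A).
  by rewrite /v /limit_row mulmxKV// limit_mx_unit.
rewrite /limit_mx mulmxBr mulmx1 -scalemxAr => /eqP; rewrite subr_eq => /eqP.
move/(congr1 (fun u : 'rV_#|F| => u 0 l)); rewrite !mxE => ->.
rewrite mulr1 -addrA -mulrDr; congr (_ + _ * _); rewrite addrC.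
by congr (_ + _); apply: eq_bigr => j _; rewrite ?zF ?zS ?enum_valP// !mxE.
Qed.

End Limit.

(** * Bounded variables and orthogonality to centred draws *)

Section BoundedMeasurable.
Context (d : measure_display) (Omega : measurableType d) (R : realType).
Context (P : probability Omega R).

(** A class of integrable functions stable under sums and products, so that integrals split without
    separate integrability arguments. *)
Definition bounded_measurable (f : Omega -> R) : Prop :=
  measurable_fun setT f /\ exists K, forall w, `|f w| <= K.

Lemma bounded_measurable_integrable (f : Omega -> R) :
  bounded_measurable f -> P.-integrable setT (EFin \o f).
Proof.
case=> mf [K fK]; apply: measurable_bounded_integrable => //.
  by rewrite (@le_lt_trans _ _ 1%E) ?ltry// probability_le1.
by exists K; split; [exact: num_real | move=> x Kx w _; exact: le_trans (ltW Kx)].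
Qed.

Lemma bounded_measurable_cst (c : R) : bounded_measurable (fun=> c).
Proof. by split; [exact: measurable_cst | exists `|c|]. Qed.

Lemma bounded_measurableD (f g : Omega -> R) :
  bounded_measurable f -> bounded_measurable g ->
  bounded_measurable (fun w => f w + g w).
Proof.
case=> mf [K fK] [mg [L gL]]; split; first exact: measurable_funD.
by exists (K + L) => w; apply: le_trans (ler_normD _ _) _; exact: lerD.
Qed.

Lemma bounded_measurableM (f g : Omega -> R) :
  bounded_measurable f -> bounded_measurable g ->
  bounded_measurable (fun w => f w * g w).
Proof.
case=> mf [K fK] [mg [L gL]]; split; first exact: measurable_funM.
by exists (K * L) => w; rewrite normrM; exact: ler_pM.
Qed.

Lemma bounded_measurable_indic (A : set Omega) : measurable A ->
  bounded_measurable \1_A.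
Proof.
move=> mA; split; first exact: measurable_indic.
by exists 1 => w; rewrite indicE; case: (_ \in _); rewrite ?normr1 ?normr0.
Qed.

Lemma Rintegral_probability_cst (c : R) : \int[P]_w c = c.
Proof. by rewrite Rintegral_cst// [X in fine X]probability_setT mulr1. Qed.

(** Orthogonality in L2, used in place of conditional expectations. Boundedness of [X] is included
    so that linear combinations can be integrated term by term. *)
Definition orthogonal_to (D X : Omega -> R) : Prop :=
  bounded_measurable X /\ \int[P]_w (X w * D w) = 0.

Section Orthogonal.
Context (D : Omega -> R) (bD : bounded_measurable D).

Lemma orthogonal_toD (X Y : Omega -> R) :
  orthogonal_to D X -> orthogonal_to D Y ->
  orthogonal_to D (fun w => X w + Y w).
Proof.
case=> bX oX [bY oY]; split; first exact: bounded_measurableD.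
under eq_Rintegral do rewrite mulrDl.
by rewrite RintegralD ?oX ?oY ?addr0//;
  exact/bounded_measurable_integrable/bounded_measurableM.
Qed.

Lemma orthogonal_toZ (c : R) (X : Omega -> R) :
  orthogonal_to D X -> orthogonal_to D (fun w => c * X w).
Proof.
case=> bX oX; split.
  by apply: bounded_measurableM => //; exact: bounded_measurable_cst.
under eq_Rintegral do rewrite -mulrA.
by rewrite RintegralZl ?oX ?mulr0//;
  exact/bounded_measurable_integrable/bounded_measurableM.
Qed.

Lemma orthogonal_to_sum (I : Type) (s : seq I) (p : pred I)
    (X : I -> Omega -> R) :
  (forall i, p i -> orthogonal_to D (X i)) ->
  orthogonal_to D (fun w => \sum_(i <- s | p i) X i w).
Proof.
move=> oX; elim: s => [|i s IH].
  rewrite [X in orthogonal_to _ X](_ : _ = fun=> 0); last first.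
    by apply/funext => w; rewrite big_nil.
  split; first exact: bounded_measurable_cst.
  by under eq_Rintegral do rewrite mul0r; rewrite Rintegral_cst// mul0r.
have [pi|pi] := boolP (p i).
  rewrite [X in orthogonal_to _ X](_ : _ =
      fun w => X i w + \sum_(i <- s | p i) X i w).
    by apply: orthogonal_toD => //; exact: oX.
  by apply/funext => w; rewrite big_cons pi.
rewrite [X in orthogonal_to _ X](_ : _ = fun w => \sum_(i <- s | p i) X i w)//.
by apply/funext => w; rewrite big_cons (negPf pi).
Qed.

End Orthogonal.

Lemma cond_prob_orthogonal_indic (G : set (set Omega)) (A C : set Omega)
    (f : Omega -> R) : measurable A -> measurable C -> G C ->
  bounded_measurable f -> is_cond_prob P G A f ->
  orthogonal_to (fun w => \1_A w - f w) \1_C.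
Proof.
move=> mA mC GC bf [_ _ /(_ C GC) fC]; split; first exact: bounded_measurable_indic.
have bA := bounded_measurable_indic mA; have bC := bounded_measurable_indic mC.
under eq_Rintegral do rewrite mulrBr.
rewrite RintegralB//;
  [|exact/bounded_measurable_integrable/bounded_measurableM..].
apply/eqP; rewrite subr_eq0; apply/eqP; congr fine.
have ind (g : Omega -> R) :
    (\int[P]_w (\1_C w * g w)%:E = \int[P]_(w in C) (g w)%:E)%E.
  rewrite [RHS]integral_mkcond; apply: eq_integral => w _.
  by rewrite patchE indicE; case: (_ \in _); rewrite ?mul1r ?mul0r.
by rewrite !ind fC integral_indic.
Qed.

(** Meant for the white-ball counts, which at a fixed time are bounded integers; finitely many
    indicators then suffice. *)
Lemma cond_prob_orthogonal_nat (G : set (set Omega)) (A : set Omega)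
    (f : Omega -> R) (n : nat) (X : Omega -> nat) :
  measurable A -> bounded_measurable f -> is_cond_prob P G A f ->
  (forall w, (X w <= n)%N) ->
  (forall v, measurable [set w | (v < X w)%N] /\ G [set w | (v < X w)%N]) ->
  orthogonal_to (fun w => \1_A w - f w) (fun w => (X w)%:R).
Proof.
move=> mA bf fA Xn GX.
(* Layer cake: [X = \sum_(v < n) 1_{v < X}]. *)
rewrite [X in orthogonal_to _ X](_ : _ =
    fun w => \sum_(v < n) \1_[set w | (v < X w)%N] w).
  apply: orthogonal_to_sum => [|v _].
    apply: bounded_measurableD; first exact: bounded_measurable_indic.
    case: bf => mf [K fK]; split; first exact: measurable_funN.
    by exists K => w; rewrite normrN.
  by have [mX GXv] := GX v; exact: cond_prob_orthogonal_indic fA.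
apply/funext => w.
rewrite (eq_bigr (fun v : 'I_n => ((v < X w)%N : nat)%:R)); last first.
  by move=> v _; rewrite indicE mem_setE.
rewrite -natr_sum; congr _%:R.
rewrite -[LHS](card_ord (X w)) -sum1_card (big_ord_widen n (fun=> 1%N) (Xn w)).
rewrite big_mkcond/=.
by apply: eq_bigr => v _; case: ifP.
Qed.

End BoundedMeasurable.

(** * Law of large numbers for orthogonal bounded increments *)

Section LawOfLargeNumbers.
Context (R : realType).

Lemma sum_inv_sqr_le2 (n : nat) : \sum_(k < n) (k.+1%:R ^+ 2)^-1 <= 2 :> R.
Proof.
case: n => [|n]; first by rewrite big_ord0.
(* The strengthened bound telescopes, because [1/(k+1)^2 <= 1/k - 1/(k+1)]. *)
suff : \sum_(k < n.+1) (k.+1%:R ^+ 2)^-1 <= 2 - n.+1%:R^-1 :> R.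
  by move/le_trans; apply; rewrite gerBl invr_ge0.
elim: n => [|n IH]; first by rewrite big_ord1 expr1n invr1; lra.
rewrite big_ord_recr/=; apply: (le_trans (lerD IH (lexx _))).
have n1 : 0 < n.+1%:R :> R by [].
rewrite -[n.+2]addn1 natrD; set x := n.+1%:R in n1 *.
rewrite -subr_ge0.
have -> : 2 - (x + 1)^-1 - (2 - x^-1 + ((x + 1) ^+ 2)^-1) =
    (x * (x + 1) ^+ 2)^-1.
  by field; rewrite gt_eqF//= gt_eqF// addr_gt0.
by rewrite invr_ge0 mulr_ge0// ltW// exprn_gt0// addr_gt0.
Qed.

(** The squares [(k+1)^2] and [(k+2)^2] differ by at most [3(k+1)], so bounded increments move [u]
    by [O(k)] between them, which is negligible against [t >= (k+1)^2]. *)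
Lemma cvg_div_from_squares (u : nat -> R) (K : R) :
  (forall t, `|u t.+1 - u t| <= K) ->
  u (k.+1 ^ 2)%N / (k.+1 ^ 2)%N%:R @[k --> \oo] --> 0 ->
  u t / t%:R @[t --> \oo] --> 0.
Proof.
move=> uK u0.
have K0 : 0 <= K by exact: le_trans (uK 0%N).
have uK' s t : `|u (s + t)%N - u s| <= K * t%:R.
  elim: t => [|t IH]; first by rewrite addn0 subrr normr0 mulr0.
  rewrite addnS -(subrK (u (s + t)%N) (u _)) -addrA -natr1 mulrDr mulr1 addrC.
  by apply: (le_trans (ler_normD _ _)); exact: lerD.
have sqrt t : exists k, (k.+1 ^ 2 <= t.+1 < k.+2 ^ 2)%N.
  elim: t => [|t [k /andP[k1 k2]]]; first by exists 0%N.
  have [|] := ltnP t.+2 (k.+2 ^ 2).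
    by exists k; rewrite (leq_trans k1)//=.
  move=> k3; exists k.+1; rewrite k3/=.
  by rewrite (leq_ltn_trans k2)// ltn_exp2r.
apply/cvgrPdist_le => e e0.
have e2 : 0 < e / 2 by rewrite divr_gt0.
move/cvgrPdist_le : u0 => /(_ _ e2)[n1 _ un1].
(* This choice gives [3K <= (e/2)(k+1)] as soon as [n2 <= k]. *)
pose n2 := Num.bound (K * 3 / (e / 2)).
exists ((maxn n1 n2).+2 ^ 2)%N => // t /= nt.
have t0 : (0 < t)%N by rewrite (leq_trans _ nt)// expn_gt0.
have [k] := sqrt t.-1; rewrite prednK// => /andP[k1 k2].
have kn : (maxn n1 n2 <= k)%N.
  have := leq_ltn_trans nt k2; rewrite ltn_exp2r// ltnS => /ltnW.
  by rewrite ltnS.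
have := un1 k (leq_trans (leq_maxl _ _) kn).
rewrite !sub0r !normrN !normrM ![`|_^-1|]ger0_norm ?invr_ge0// => uk.
have tR : 0 < t%:R :> R by rewrite ltr0n.
have k1R : 0 < (k.+1 ^ 2)%N%:R :> R by rewrite ltr0n expn_gt0.
rewrite ler_pdivrMr//; rewrite ler_pdivrMr// in uk.
have := uK' (k.+1 ^ 2)%N (t - k.+1 ^ 2)%N; rewrite subnKC// => ut.
have kt : (k.+1 ^ 2)%N%:R <= t%:R :> R by rewrite ler_nat.
have tk : (t - k.+1 ^ 2)%N%:R <= 3 * k.+1%:R :> R.
  rewrite -natrM ler_nat leq_subLR (leq_trans (ltnW k2))//.
  by rewrite -[k.+2]addn1 sqrnD exp1n muln1 -addnA leq_add2l; lia.
have Ke : K * 3 <= e / 2 * k.+1%:R.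
  rewrite -ler_pdivrMl// mulrC; apply: (@le_trans _ _ n2%:R).
    by apply/ltW/archi_boundP; rewrite divr_ge0 ?mulr_ge0// ltW.
  by rewrite ler_nat (leq_trans _ (leqW kn))// leq_maxr.
rewrite -(subrK (u (k.+1 ^ 2)%N) (u t)).
apply: (le_trans (ler_normD _ _)).
rewrite [e](splitr e) mulrDl; apply: lerD; last first.
  by apply: (le_trans uk); rewrite ler_pM2l.
apply: (le_trans ut); apply: (le_trans (ler_wpM2l K0 tk)).
rewrite mulrA; apply: (le_trans (ler_wpM2r _ Ke)) => //.
by rewrite -[leLHS]mulrA ler_pM2l// -natrM mulnn.
Qed.

End LawOfLargeNumbers.

Section OrthogonalIncrements.
Context (d : measure_display) (Omega : measurableType d) (R : realType).
Context (P : probability Omega R).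

(** Orthogonality gives [E U_t^2 <= K^2 t]. Along [t = (k+1)^2] the second moments of [U_t / t] are
    then at most [K^2/(k+1)^2], which is summable, and bounded increments fill the gaps between
    squares. *)
Lemma orthogonal_increments_lln (U : nat -> Omega -> R) (K : R) :
  (forall w, U 0%N w = 0) ->
  (forall t, measurable_fun setT (U t)) ->
  (forall t w, `|U t.+1 w - U t w| <= K) ->
  (forall t, \int[P]_w (U t w * (U t.+1 w - U t w)) = 0) ->
  {ae P, forall w, U t w / t%:R @[t --> \oo] --> 0}.
Proof.
move=> U0 mU UK oU.
have bU t : bounded_measurable (U t).
  split => //; exists (K * t%:R) => w; elim: t => [|t IH].
    by rewrite U0 normr0 mulr0.
  rewrite -(subrK (U t w) (U _ _)) -natr1 mulrDr mulr1 addrC.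
  by apply: (le_trans (ler_normD _ _)); exact: lerD.
have bD t : bounded_measurable (fun w => U t.+1 w - U t w).
  by split; [exact: measurable_funB | exists K].
have bM f g := @bounded_measurableM _ Omega R f g.
have int f := @bounded_measurable_integrable _ Omega R P f.
have U2 t : \int[P]_w (U t w ^+ 2) <= K ^+ 2 * t%:R.
  elim: t => [|t IH].
    under eq_Rintegral do rewrite U0 expr0n/=.
    by rewrite Rintegral_cst// mul0r mulr0.
  pose D w := U t.+1 w - U t w.
  have -> : \int[P]_w (U t.+1 w ^+ 2) =
      \int[P]_w (U t w * U t w + 2 * (U t w * D w) + D w * D w).
    by apply: eq_Rintegral => w _; rewrite /D; ring.
  have i1 := int _ (bM _ _ (bU t) (bU t)).
  have i2 := bM _ _ (bU t) (bD t).
  have i3 := int _ (bM _ _ (bounded_measurable_cst _ 2) i2).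
  have i4 := int _ (bM _ _ (bD t) (bD t)).
  have i5 := int _ (bounded_measurableD (bM _ _ (bU t) (bU t))
     (bM _ _ (bounded_measurable_cst _ 2) i2)).
  rewrite RintegralD// RintegralD// RintegralZl//; last exact: int.
  rewrite oU mulr0 addr0 -natr1 mulrDr mulr1; apply: lerD.
    by under eq_Rintegral do rewrite -expr2.
  rewrite -[leRHS](Rintegral_probability_cst P).
  apply: le_Rintegral => // [|w _]; first exact: int (bounded_measurable_cst _ _).
  by rewrite -expr2 -real_normK ?num_real// ler_pXn2r ?nnegrE// (le_trans _ (UK t w)).
pose V k w := (U (k.+1 ^ 2)%N w / (k.+1 ^ 2)%N%:R) ^+ 2.
have bV k : bounded_measurable (V k).
  rewrite /V; under [X in bounded_measurable X]eq_fun do rewrite expr2.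
  by apply: (bM) => //; apply: (bM) => //; exact: bounded_measurable_cst.
have V_ge0 k w : 0 <= V k w by exact: sqr_ge0.
have VE k : \int[P]_w V k w <= K ^+ 2 * (k.+1%:R ^+ 2)^-1.
  rewrite /V; under eq_Rintegral do rewrite exprMn mulrC.
  rewrite RintegralZl//; last first.
    by apply: int; under [X in bounded_measurable X]eq_fun do rewrite expr2; exact: bM.
  apply: (le_trans (ler_wpM2l (sqr_ge0 _) (U2 _))).
  by rewrite natrX le_eqVlt; apply/orP; left; apply/eqP; field.
(* A nonnegative series with finite expectation is finite almost surely, so its terms tend to 0. *)
have sumV : (\int[P]_w (\sum_(0 <= k <oo) (V k w)%:E) < +oo)%E.
  rewrite integral_nneseries//; last 2 first.
    by move=> k; apply/measurable_EFinP; have [] := bV k.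
    by move=> k w _; rewrite lee_fin.
  apply: (@le_lt_trans _ _ (K ^+ 2 * 2)%:E); last exact: ltry.
  apply: lime_le.
    by apply: is_cvg_nneseries => k _ _; apply: integral_ge0 => w _; rewrite lee_fin.
  apply: nearW => n.
  have -> : (\sum_(0 <= k < n) \int[P]_w (V k w)%:E =
      (\sum_(0 <= k < n) \int[P]_w V k w)%:E)%E.
    rewrite -sumEFin; apply: eq_bigr => k _.
    by rewrite /Rintegral fineK// integrable_fin_num// int.
  rewrite lee_fin big_mkord.
  apply: (@le_trans _ _ (\sum_(k < n) K ^+ 2 * (k.+1%:R ^+ 2)^-1)).
    by apply: ler_sum => k _; exact: VE.
  by rewrite -mulr_sumr ler_wpM2l ?sqr_ge0// sum_inv_sqr_le2.
have : P.-integrable setT (fun w => \sum_(0 <= k <oo) (V k w)%:E)%E.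
  apply/integrableP; split.
    apply: ge0_emeasurable_sum => [k w _ _|k _]; first by rewrite lee_fin.
    by apply/measurable_EFinP; have [] := bV k.
  under eq_integral => w _.
    rewrite gee0_abs; last by apply: nneseries_ge0 => k _ _; rewrite lee_fin.
    over.
  exact: sumV.
move/(integrable_ae measurableT); apply: filterS => w /(_ I) fV.
apply: (@cvg_div_from_squares _ (U^~ w) K) => [t|]; first exact: UK.
have /cvg_series_cvg_0 /cvgrPdist_le V0 : cvgn (series (V^~ w)).
  by apply: nnseries_is_cvg => //; rewrite ltey_eq fV.
apply/cvgrPdist_le => e e0.
have := V0 _ (exprn_gt0 2 e0); apply: filterS => k.
by rewrite !sub0r !normrN normrX ler_pXn2r ?nnegrE// ltW.
Qed.

End OrthogonalIncrements.

(** * The urn process: drift, fluctuation and averaging recursion *)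

Section UrnProcess.
Context (R : realType) (d : measure_display) (Omega : measurableType d).
Context (P : probability Omega R) (N : nat) (E : rel 'I_N).
Context (m alpha beta : nat) (W0 B0 : 'I_N -> nat).
Context (W B : nat -> 'I_N -> Omega -> nat) (Y : nat -> 'I_N -> {RV P >-> bool}).
Hypotheses (m_gt0 : (0 < m)%N) (alpha_le : (alpha <= m)%N).
Hypotheses (beta_le : (beta <= m)%N) (T0_ge1 : forall i, (1 <= W0 i + B0 i)%N).
Hypothesis urn : urn_process E m alpha beta W0 B0 W B Y.

Local Notation a := (alpha%:R / m%:R : R).
Local Notation b := (beta%:R / m%:R : R).
Local Notation c := (a + b - 1).
Local Notation z t i := (fun w => Z R W B t w 0 i).
Local Notation deg := (in_degree E).

Let T (t : nat) (i : 'I_N) : nat := (W0 i + B0 i + t * (m * deg i))%N.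

(** Each draw at an in-neighbour adds exactly [m] balls whatever its colour, so the total is
    deterministic. *)
Lemma urn_total (t : nat) (i : 'I_N) (w : Omega) :
  (W t i w + B t i w = T t i)%N.
Proof.
elim: t => [|t IH]; first by rewrite (urn_W0 urn) (urn_B0 urn) /T mul0n addn0.
rewrite (urn_WS urn) (urn_BS urn) addnACA IH -big_split/=.
rewrite (eq_bigr (fun=> m)) => [|j _]; last by case: (Y _ _ _) => /=; lia.
by rewrite sum_nat_const /T mulSn [X in _ = (_ + X)%N]addnC addnA [(#|_| * _)%N]mulnC.
Qed.

Lemma total_gt0 (t : nat) (i : 'I_N) : 0 < (T t i)%:R :> R.
Proof. by rewrite ltr0n addn_gt0 T0_ge1. Qed.

Lemma white_ZE (t : nat) (i : 'I_N) (w : Omega) :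
  (W t i w)%:R = (T t i)%:R * z t i w.
Proof.
rewrite /= mxE /white_fraction -natrD urn_total mulrCA divff ?mulr1//.
by rewrite gt_eqF// total_gt0.
Qed.

Lemma Z_bounds (t : nat) (i : 'I_N) (w : Omega) : 0 <= z t i w <= 1.
Proof.
rewrite /= mxE /white_fraction -natrD urn_total divr_ge0//=.
by rewrite ler_pdivrMr ?total_gt0// mul1r ler_nat -(urn_total t i w) leq_addr.
Qed.

Lemma Z_bounded_measurable (t : nat) (i : 'I_N) :
  bounded_measurable (z t i).
Proof.
(* Measurability of the proportion comes from the integrability clause of [is_cond_prob]. *)
split; first by have [_ /measurable_int/measurable_EFinP] := urn_draw urn t i.
by exists 1 => w; have /andP[? ?] := Z_bounds t i w; rewrite ger0_norm.
Qed.

Lemma Z_filtration_preimage (s t : nat) (i : 'I_N) (C : set R) :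
  (s <= t)%N -> measurable C -> Z_filtration R W B t (z s i @^-1` C).
Proof. by move=> st mC; apply: sub_sigma_algebra; exists s, i, C. Qed.

Local Notation draw t i := [set w | Y t.+1 i w = true].

Let D (t : nat) (i : 'I_N) (w : Omega) : R := \1_(draw t i) w - z t i w.

Lemma draw_indicE (t : nat) (i : 'I_N) (w : Omega) :
  \1_(draw t i) w = (Y t.+1 i w : nat)%:R :> R.
Proof.
rewrite indicE; congr (nat_of_bool _)%:R.
by apply/idP/idP; rewrite inE.
Qed.

Lemma measurable_draw (t : nat) (i : 'I_N) : measurable (draw t i).
Proof.
rewrite -[X in measurable X]setTI.
by have /(_ measurableT [set true] I) := measurable_funPT (Y t.+1 i).
Qed.

Lemma D_bounded_measurable (t : nat) (i : 'I_N) : bounded_measurable (D t i).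
Proof.
apply: bounded_measurableD.
  exact/bounded_measurable_indic/measurable_draw.
have [mz [K zK]] := Z_bounded_measurable t i.
by split; [exact: measurable_funN | exists K => w; rewrite normrN].
Qed.

Lemma Z_orthogonal_to_draw (s t : nat) (i j : 'I_N) : (s <= t)%N ->
  orthogonal_to P (D t j) (z s i).
Proof.
move=> st.
rewrite [X in orthogonal_to _ _ X](_ : _ =
    fun w => (T s i)%:R^-1 * (W s i w)%:R); last first.
  by apply/funext => w; rewrite white_ZE mulKf// gt_eqF ?total_gt0.
apply: (orthogonal_toZ (D_bounded_measurable t j)).
apply: (@cond_prob_orthogonal_nat _ _ _ _ (Z_filtration R W B t) _ _ (T s i)).
- exact: measurable_draw.
- exact: Z_bounded_measurable.
- exact: (urn_draw urn).
- by move=> w; rewrite -(urn_total s i w) leq_addr.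
(* The filtration is generated by proportions, so the event that the count exceeds [v] is rewritten
   as one on [z s i], the total being deterministic. *)
move=> v; rewrite [X in measurable X /\ _ X](_ : _ =
    z s i @^-1` `]v%:R / (T s i)%:R, +oo[).
  split; last exact: Z_filtration_preimage.
  rewrite -[X in measurable X]setTI.
  by have [mz _] := Z_bounded_measurable s i; exact: mz.
apply/seteqP; split => w; rewrite /= in_itv/= andbT ltr_pdivrMr ?total_gt0//;
  by rewrite mulrC -white_ZE ltr_nat.
Qed.

Lemma cst_orthogonal_to_draw (t : nat) (j : 'I_N) (r : R) :
  orthogonal_to P (D t j) (fun=> r).
Proof.
split; first exact: bounded_measurable_cst.
have GT : Z_filtration R W B t setT.
  rewrite (_ : setT = z t j @^-1` setT); last by rewrite preimage_setT.
  exact: Z_filtration_preimage.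
have [_ o1] := cond_prob_orthogonal_indic (measurable_draw t j) measurableT GT
  (Z_bounded_measurable t j) (urn_draw urn t j).
rewrite RintegralZl//; last exact/bounded_measurable_integrable/D_bounded_measurable.
apply/eqP; rewrite mulf_eq0; apply/orP; right; apply/eqP.
by rewrite -[RHS]o1; apply: eq_Rintegral => w _; rewrite indicT mul1r.
Qed.

Let U (i : 'I_N) (t : nat) (w : Omega) : R :=
  c * \sum_(s < t) \sum_(j in in_nbrs E i) D s j w.

(** An in-neighbour contributes [alpha Y + (m - beta)(1 - Y) = m(1 - b) + m c Y], and [Y] is the
    proportion plus the centred draw. *)
Lemma white_decomposition (t : nat) (i : 'I_N) (w : Omega) :
  (W t i w)%:R = (W0 i)%:R + t%:R * (m%:R * (deg i)%:R) * (1 - b) +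
    m%:R * (c * \sum_(s < t) \sum_(j in in_nbrs E i) z s j w) + m%:R * U i t w.
Proof.
have m0 : m%:R != 0 :> R by rewrite pnatr_eq0 -lt0n.
rewrite /U; elim: t => [|t IH].
  by rewrite !big_ord0 !mulr0 !mul0r !addr0 (urn_W0 urn).
rewrite (urn_WS urn) natrD IH natr_sum !big_ord_recr/=.
rewrite (eq_bigr (fun j => m%:R * (1 - b) + m%:R * c * (z t j w + D t j w))).
  rewrite big_split/= sumr_const -mulr_sumr big_split/= -[_ *+ _]mulr_natl.
  by rewrite -/(in_degree E i) -natr1; ring.
move=> j _; rewrite /D [X in _ = _ + _ * X]addrC subrK draw_indicE.
by case: (Y _ _ _); rewrite ?subnn ?subn0 ?muln1 ?muln0 ?addn0 ?add0n
  ?natrB//=; field.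
Qed.

Lemma fluctuation_vanishes (i : 'I_N) :
  {ae P, forall w, U i t w / t%:R @[t --> \oo] --> 0}.
Proof.
have m0 : m%:R != 0 :> R by rewrite pnatr_eq0 -lt0n.
have US t w : U i t.+1 w - U i t w = \sum_(j in in_nbrs E i) c * D t j w.
  by rewrite /U big_ord_recr/= mulrDr addrAC subrr add0r mulr_sumr.
have oU t j : orthogonal_to P (D t j) (U i t).
  (* The draws need not be measurable with respect to the filtration, which is
     generated by [Z] alone, but [U i t] is a linear combination of the [Z]'s. *)
  have UE : U i t = fun w => - (((W0 i)%:R +
        t%:R * (m%:R * (deg i)%:R) * (1 - b)) / m%:R) +
      ((T t i)%:R / m%:R * z t i w + (- c) *
        \sum_(s < t) \sum_(k in in_nbrs E i) z s k w).
    apply/funext => w; have := white_decomposition t i w; rewrite white_ZE.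
    set A := (_ + _ * (1 - b)); set S := \sum_(s < t) _; set V := U i t w.
    move=> e; apply: (mulfI m0).
    have -> : m%:R * V = (T t i)%:R * z t i w - A - m%:R * (c * S).
      by rewrite e; ring.
    by field.
  have oD := orthogonal_toD (D_bounded_measurable t j).
  have oZ := orthogonal_toZ (D_bounded_measurable t j).
  rewrite UE; apply: (oD); first exact: cst_orthogonal_to_draw.
  apply: (oD); first by apply: (oZ); exact: Z_orthogonal_to_draw.
  apply: (oZ); apply: (orthogonal_to_sum (D_bounded_measurable t j)) => s _.
  apply: (orthogonal_to_sum (D_bounded_measurable t j)) => k _.
  by apply: Z_orthogonal_to_draw; exact: ltnW.
have DK t j w : `|D t j w| <= 1.
  have /andP[z0 z1] := Z_bounds t j w.
  by rewrite /D indicE ler_norml; case: (_ \in _) => /=; lra.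
have bU t : bounded_measurable (U i t) by have [] := oU t i.
apply: (@orthogonal_increments_lln _ _ _ _ _ (\sum_(j in in_nbrs E i) `|c|)).
- by move=> w; rewrite /U big_ord0 mulr0.
- by move=> t; have [] := bU t.
- move=> t w; rewrite US; apply: (le_trans (ler_norm_sum _ _ _)).
  by apply: ler_sum => j _; rewrite normrM ler_piMr.
move=> t; under eq_Rintegral do rewrite US mulrC.
(* Orthogonality is used with the roles exchanged, [U i t] being the fixed function, to sum over the
   draws by linearity. *)
have [] // := @orthogonal_to_sum _ _ _ P _ (bU t) _ (index_enum _)
  (mem (in_nbrs E i)) (fun j w => c * D t j w).
move=> j _; apply: (orthogonal_toZ (bU t)); split.
  exact: D_bounded_measurable.
by have [_ <-] := oU t j; apply: eq_Rintegral => w _; rewrite mulrC.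
Qed.

(** Dividing [white_decomposition] by [t m d_i] rather than by the total leaves a remainder of order
    [1/t] from the initial balls. *)
Lemma Z_mean_recursion (i : 'I_N) (w : Omega) : i \in flexible E ->
  U i t w / t%:R @[t --> \oo] --> 0 ->
  z t i w - ((1 - b) + c * \sum_j mean (fun s => z s j w) t *
    scaled_adjacency E R j i) @[t --> \oo] --> 0.
Proof.
rewrite inE => di U0; have m0 : 0 < m%:R :> R by rewrite ltr0n.
have d1 : 1 <= (deg i)%:R :> R by rewrite ler1n.
have m1 : 1 <= m%:R :> R by rewrite ler1n.
have d0 : 0 < (deg i)%:R :> R by rewrite ltr0n.
set T0 : R := (W0 i + B0 i)%:R.
apply/cvgrPdist_le => e e0.
have e2 : 0 < e / 2 by rewrite divr_gt0.
move/cvgrPdist_le : U0 => /(_ _ e2) U0.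
near=> t; rewrite sub0r normrN.
have t0 : 0 < t%:R :> R by rewrite ltr0n; near: t; exact: nbhs_infty_gt.
have Ut : `|U i t w / t%:R| <= e / 2.
  by rewrite -normrN -sub0r; near: t.
(* Since [|W0 i - T0 z| <= T0] and [m d_i >= 1], this bounds the remainder by [e / 2]. *)
have Tt : T0 / (e / 2) <= t%:R by near: t; exact: nbhs_infty_ger.
rewrite sum_scaled_adjacency -mulr_suml.
have -> : z t i w - (1 - b + c * ((\sum_(j in in_nbrs E i)
      \sum_(s < t) z s j w) / t%:R / (deg i)%:R)) =
    ((W0 i)%:R - T0 * z t i w) / (t%:R * (m%:R * (deg i)%:R)) +
    U i t w / t%:R / (deg i)%:R.
  have := white_decomposition t i w.
  rewrite white_ZE /T natrD -/T0 natrM natrM exchange_big/=.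
  set S := \sum_(j in _) _; set z := Z _ _ _ _ _ _ _; set u := U i t w.
  move=> e1; have {e1} -> : (W0 i)%:R = T0 * z + t%:R * (m%:R * (deg i)%:R) * z -
      t%:R * (m%:R * (deg i)%:R) * (1 - b) - m%:R * (c * S) - m%:R * u.
    by apply/eqP; rewrite -subr_eq0; move/eqP: e1; rewrite -subr_eq0 => /eqP e1;
       apply/eqP; rewrite -[RHS]oppr0 -[in RHS]e1; ring.
  by field; rewrite !gt_eqF.
rewrite [e]splitr; apply: (le_trans (ler_normD _ _)); apply: lerD; last first.
  rewrite normrM; apply: (le_trans _ Ut); rewrite ler_piMr//.
  by rewrite ger0_norm ?invr_ge0// ?invf_le1// ltW.
have md1 : 1 <= m%:R * (deg i)%:R :> R by rewrite -[leLHS]mulr1 ler_pM.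
have tmd : 0 < t%:R * (m%:R * (deg i)%:R) :> R by rewrite mulr_gt0// mulr_gt0.
rewrite normrM [X in _ * X]ger0_norm ?invr_ge0; last exact: ltW.
rewrite ler_pdivrMr//; apply: (@le_trans _ _ T0).
  have /andP[z0 z1] := Z_bounds t i w.
  have TW : (W0 i)%:R <= T0 by rewrite ler_nat leq_addr.
  have W00 : 0 <= (W0 i)%:R :> R by [].
  by rewrite ler_norml; nra.
rewrite ler_pdivrMr// in Tt; apply: (le_trans Tt).
by rewrite mulrC ler_pM2l// ler_peMr// ltW.
Unshelve. all: by end_near. Qed.

End UrnProcess.

(** * Almost sure convergence of the proportions *)

Lemma cvg_mx_entrywise (R : realType) (k l : nat) (u : nat -> 'M[R]_(k, l))
    (v : 'M[R]_(k, l)) :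
  (forall i j, u t i j @[t --> \oo] --> v i j) -> u t @[t --> \oo] --> v.
Proof.
move=> uv; apply/cvg_mx_entourageP => A entA.
apply: filter_forall => i; apply: filter_forall => j.
have /cvg_entourageP/(_ _ entA) := uv i j.
by rewrite !near_map; apply: filterS => t; rewrite inE.
Qed.

Theorem theorem4p1 (R : realType) (d : measure_display)
    (Omega : measurableType d) (P : probability Omega R)
    (N : nat) (E : rel 'I_N) (m alpha beta : nat) (W0 B0 : 'I_N -> nat)
    (W B : nat -> 'I_N -> Omega -> nat) (Y : nat -> 'I_N -> {RV P >-> bool})
    (no_isolated : no_isolated_vertex E)
    (m_gt0 : (0 < m)%N) (alpha_le : (alpha <= m)%N) (beta_le : (beta <= m)%N)
    (T0_ge1 : forall i, (1 <= W0 i + B0 i)%N)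
    (urn : urn_process E m alpha beta W0 B0 W B Y) :
  let a : R := alpha%:R / m%:R in
  let b : R := beta%:R / m%:R in
  let Z0 : 'rV[R]_N := \row_i white_fraction R (W0 i) (B0 i) in
  (replacement_mx m alpha beta <> (m%:Z)%:M /\ 0 < a + b) \/
  (stubborn E <> finset.set0 /\
   forall f, f \in flexible E ->
     exists2 s, s \in stubborn E & connect E s f) ->
  limit_mx E a b \in unitmx /\
  {ae P, forall w, subrow (flexible E) (Z R W B t w) @[t --> \oo] -->
     limit_row E a b Z0}.
Proof.
move=> a b Z0 hyp.
have m0 : 0 < m%:R :> R by rewrite ltr0n.
have a0 : 0 <= a by rewrite divr_ge0.
have b0 : 0 <= b by rewrite divr_ge0.
have a1 : a <= 1 by rewrite ler_pdivrMr// mul1r ler_nat.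
have b1 : b <= 1 by rewrite ler_pdivrMr// mul1r ler_nat.
have cE : contracting E (a + b - 1).
  case: hyp => [[Rm ab0]|[_ reach]]; [left|right]; last first.
    by split=> //; rewrite ler_norml; lra.
  (* [a + b > 0] gives [c > -1], and [c < 1] fails only for [a = b = 1], that is, [R = mI]. *)
  suff : a + b < 2 by move=> ab2; rewrite ltr_norml; lra.
  have [am|am] := eqVneq alpha m; last first.
    suff : a < 1 by lra.
    by rewrite ltr_pdivrMr// mul1r ltr_nat ltn_neqAle am.
  have [bm|bm] := eqVneq beta m; last first.
    suff : b < 1 by lra.
    by rewrite ltr_pdivrMr// mul1r ltr_nat ltn_neqAle bm.
  case: Rm; rewrite am bm; apply/matrixP => i j; rewrite !mxE subrr.
  by case: i => [[|[|//]] ?]; case: j => [[|[|//]] ?].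
split; first exact: limit_mx_unit.
have [zs [zF zS zfix]] := limit_fixed_point cE Z0.
(* There are finitely many vertices, so one null set serves for all the fluctuations. *)
have aeP : Filter (almost_everywhere P) by exact: _.
have := filter_forall aeP (fluctuation_vanishes m_gt0 alpha_le beta_le T0_ge1 urn).
apply: filterS => w U0.
apply: cvg_mx_entrywise => i0 k; rewrite ord1 -zF.
pose x (i : 'I_N) (t : nat) : R := Z R W B t w 0 i - zs i.
have zb := Z_bounds m_gt0 alpha_le beta_le T0_ge1 urn.
have x0 i : x i t @[t --> \oo] --> 0.
  move: i; apply: (mean_recursion_cvg (K := 1 + \sum_i `|zs i|) cE).
  - move=> i t; apply: (le_trans (ler_normB _ _)); apply: lerD.
      by have /andP[z0 z1] := zb t i w; rewrite ger0_norm.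
    by rewrite (bigD1 i)//= lerDl sumr_ge0.
  - move=> i t iS; rewrite /x zS// !mxE.
    have d0 : in_degree E i = 0%N by apply/eqP; move: iS; rewrite inE.
    have nbr0 : in_nbrs E i = finset.set0.
      by apply/eqP; rewrite -cards_eq0 -/(in_degree E i) d0.
    have -> : W t i w = W0 i.
      elim: t => [|t IH]; first exact: (urn_W0 urn).
      by rewrite (urn_WS urn) nbr0 big_set0 addn0.
    have -> : B t i w = B0 i.
      elim: t => [|t IH]; first exact: (urn_B0 urn).
      by rewrite (urn_BS urn) nbr0 big_set0 addn0.
    by rewrite subrr.
  - move=> i iF.
    have := Z_mean_recursion m_gt0 alpha_le beta_le T0_ge1 urn iF (U0 i).
    (* The mean of the constant [zs j] is [zs j] for [t > 0], where the fixed-point equation cancels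
       the constants, but 0 at [t = 0]; hence the equality is only claimed eventually. *)
    apply: cvg_trans; apply: near_eq_cvg; near=> t.
    have t0 : t%:R != 0 :> R.
      by rewrite pnatr_eq0 -lt0n; near: t; exact: nbhs_infty_gt.
    rewrite /x zfix// -/a -/b.
    have -> : \sum_j mean (fun s => Z R W B s w 0 j - zs j) t *
          scaled_adjacency E R j i =
        \sum_j mean (fun s => Z R W B s w 0 j) t * scaled_adjacency E R j i -
        \sum_j zs j * scaled_adjacency E R j i.
      rewrite -sumrB; apply: eq_bigr => j _; rewrite -mulrBl; congr (_ * _).
      by rewrite /mean sumrB sumr_const card_ord -[zs j *+ _]mulr_natr mulrBl mulfK.
    by rewrite /=; ring.
rewrite [X in X @ _ --> _](_ : _ = fun t => x (enum_val k) t + zs (enum_val k)).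
  rewrite -[X in _ --> X]add0r; apply: cvgD; [exact: x0 | exact: cvg_cst].
by apply/funext => t; rewrite /x mxE subrK.
Unshelve. all: by end_near. Qed.
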